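(* There is an absolute constant $C$ such that the following holds. Let $G=(V,E)$ be a finite connected simple graph with $n$ vertices, $m$ edges, minimum degree $\delta$ and maximum degree $\Delta$, and consider any unweighted deterministic walk on $G$ with $\tilde\kappa=1$ (each rotor sequence is a permutation of the neighbours), any initial rotor positions and any start vertex. Then for every $1\le\mathcal N\le n$, the walk has visited at least $\mathcal N$ distinct vertices within $C\min\{\mathcal N\Delta+(\mathcal N\Delta/\delta)^2,\ m+(m/\delta)^2\}$ steps, and for every $1\le\mathcal M\le m$, it has traversed at least $\mathcal M$ distinct edges within $C\,(\mathcal M+(\mathcal M/\delta)^2)$ steps.
   Context: Unweighted deterministic walk: each vertex $u$ has a rotor sequence of length $\tilde d(u)$ of neighbours of $u$, each occurring exactly $\tilde d(u)/\deg(u)$ times, and an initial rotor position; $\tilde\kappa=\max_u\tilde d(u)/\deg(u)$. From the current vertex $\tilde x_t$ the walk moves to $\tilde x_{t+1}$, the vertex the rotor of $\tilde x_t$ points at, after which that rotor advances cyclically to the next entry of its sequence; the edge traversed in step $t+1$ is $\{\tilde x_t,\tilde x_{t+1}\}$. *)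

(* Defs.v *)
From mathcomp Require Import all_boot.

Set Implicit Arguments.
Unset Strict Implicit.
Unset Printing Implicit Defensive.

Section Graph.

Variables (T : finType) (e : rel T).

Definition simple_graph : Prop := symmetric e /\ irreflexive e.

Definition connected_graph : Prop := forall u v : T, connect e u v.

Definition edges : {set {set T}} :=
  [set [set p.1; p.2] | p : T * T & e p.1 p.2].

Definition deg (u : T) : nat := #|[set v | e u v]|.

(* The neutral element #|T| exceeds the degree of every vertex of a simple
   graph, so it does not affect the minimum (there is at least one vertex). *)
Definition min_deg : nat := \big[minn/#|T|]_(u : T) deg u.

Definition max_deg : nat := \max_(u : T) deg u.

End Graph.

Section DeterministicWalk.

Variables (T : finType) (e : rel T).

(* rseq u is the rotor sequence of u, so d~(u) = size (rseq u).  The division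
   is exact, and nonemptiness forces 0 < deg e u. *)
Definition rotor_sequences (rseq : T -> seq T) : Prop :=
  forall u, [/\ 0 < size (rseq u),
                deg e u %| size (rseq u),
                {subset rseq u <= e u} &
                forall v, e u v ->
                  count_mem v (rseq u) = size (rseq u) %/ deg e u].

Definition kappa (rseq : T -> seq T) : nat :=
  \max_(u : T) (size (rseq u) %/ deg e u).

Definition rotor_positions (rseq : T -> seq T) (pos : T -> nat) : Prop :=
  forall u, pos u < size (rseq u).

(* A state is the current vertex together with all the rotor positions. *)
Definition walk_step (rseq : T -> seq T) (st : T * (T -> nat)) :
    T * (T -> nat) :=
  let: (x, pos) := st in
  (nth x (rseq x) (pos x),
   fun u => if u == x then (pos x).+1 %% size (rseq x) else pos u).

Definition walk (rseq : T -> seq T) (pos : T -> nat) (x : T) (t : nat) : T :=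
  (iter t (walk_step rseq) (x, pos)).1.

Definition visited_vertices (w : nat -> T) (t : nat) : {set T} :=
  [set w i | i : 'I_t.+1].

Definition traversed_edges (w : nat -> T) (t : nat) : {set {set T}} :=
  [set [set w i; w i.+1] | i : 'I_t].

End DeterministicWalk.

(* Main.v *)
Require Import Defs.
From mathcomp Require Import all_boot all_order all_algebra zify.

(** Cut the walk into phases that start and end at the start vertex x, a phase
    ending when some vertex u is about to be left for the (deg u + 1)-st time.
    Every arc is used at most once in a phase, so u can then have been entered
    at most deg u times, which forces u = x.  A vertex visited in one phase is
    left through all its arcs in the next one, so phase k + 1 uses all arcs
    out of the ball of radius k around x.  As long as fewer than M edges have
    been traversed, a phase lasts fewer than 2M steps, and the ball of radius
    3q, unless it is everything, has at least q delta vertices, hence at least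
    q delta^2 / 2 incident edges; so there are O(1 + M / delta^2) phases.  For
    the vertices, take M = min (N Delta, m). *)

Set Implicit Arguments.
Unset Strict Implicit.
Unset Printing Implicit Defensive.

(** * Rotor walks without rotors, and counting of departures *)

Section RotorWalk.

Variables (T : finType) (e : rel T) (w : nat -> T).
Hypothesis e_sym : symmetric e.

Definition visits (u : T) (a b : nat) : nat := \sum_(a <= i < b) (w i == u).

(** All that is kept of the rotors: an arc recurs only after full turns of the rotor at its tail.
    Since [visits] ranges over a half-open interval, it counts departures. *)
Definition rotor_walk : Prop :=
  (forall i, e (w i) (w i.+1)) /\
  (forall i j, i <= j -> w i = w j -> w i.+1 = w j.+1 ->
     deg e (w i) %| visits (w i) i j).

Hypothesis w_rotor : rotor_walk.

Lemma visits_cat u a b c : a <= b -> b <= c ->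
  visits u a c = visits u a b + visits u b c.
Proof. by move=> ab bc; rewrite /visits (big_cat_nat ab bc). Qed.

Lemma visits_recl u a b : a < b ->
  visits u a b = (w a == u) + visits u a.+1 b.
Proof. by move=> ab; rewrite /visits big_ltn. Qed.

Lemma visits_recr u a b : a <= b ->
  visits u a b.+1 = visits u a b + (w b == u).
Proof. by move=> ab; rewrite /visits big_nat_recr. Qed.

Lemma visits_shift u a b : a <= b ->
  visits u a.+1 b.+1 + (w a == u) = visits u a b + (w b == u).
Proof.
by move=> ab; rewrite addnC -visits_recl // visits_recr.
Qed.

Lemma visits_gt0 u a b : 0 < visits u a b ->
  exists2 i, a <= i < b & w i = u.
Proof.
have [|/hasPn no_visit] := boolP (has (fun i => w i == u) (index_iota a b)).
  by case/hasP=> i; rewrite mem_index_iota => ? /eqP; exists i.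
rewrite /visits big_seq big1 // => i /no_visit.
by case: eqP.
Qed.

Lemma sum_visits a b : \sum_u visits u a b = b - a.
Proof.
rewrite /visits exchange_big /= (eq_bigr (fun=> 1)) => [|i _].
  by rewrite sum_nat_const_nat muln1.
by rewrite (bigD1 (w i)) //= eqxx big1 // => u; rewrite eq_sym => /negbTE ->.
Qed.

(** * Time intervals in which no rotor makes more than one turn *)

Definition no_overflow (a b : nat) : Prop := forall u, visits u a b <= deg e u.

(** Two uses of one arc enclose a positive multiple of the degree of its tail in departures; the
    later use itself would be one departure too many. *)
Lemma no_overflow_inj a b i j : no_overflow a b ->
  a <= i < b -> a <= j < b -> w i = w j -> w i.+1 = w j.+1 -> i = j.
Proof.
move=> noab; wlog ij : i j / i <= j => [wlg|] ib jb ww ww1.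
  by case: (leqP i j) => [|/ltnW] ij; [|symmetry]; apply: wlg.
apply/eqP; apply: contraT => neq_ij; have {neq_ij}ij' : i < j by lia.
have := w_rotor.2 i j ij ww ww1; have := noab (w i).
have [ai ib' jb'] : [/\ a <= i, i <= b & j < b] by split; lia.
rewrite (visits_cat _ ai ib') (visits_cat _ ij (ltnW jb')) (visits_recl _ jb').
by rewrite (visits_recl _ ij') ww !eqxx => + /dvdn_leq; lia.
Qed.

Definition entries (v : T) (a b : nat) : seq T :=
  [seq w i | i <- index_iota a b & w i.+1 == v].

Lemma size_entries v a b : size (entries v a b) = visits v a.+1 b.+1.
Proof.
rewrite size_map size_filter -sum1_count big_mkcond /visits big_add1.
by apply: eq_bigr => i _; case: eqP.
Qed.

Lemma uniq_entries v a b : no_overflow a b -> uniq (entries v a b).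
Proof.
move=> noab; rewrite map_inj_in_uniq ?filter_uniq ?iota_uniq // => i j.
rewrite !mem_filter !mem_index_iota => /andP[/eqP wi ib] /andP[/eqP wj jb] ww.
by apply: no_overflow_inj ww _ => //; rewrite wi.
Qed.

Lemma sub_entries v a b : {subset entries v a b <= enum [set u | e v u]}.
Proof.
move=> u /mapP[i]; rewrite mem_filter => /andP[/eqP <- _] ->.
by rewrite mem_enum inE e_sym w_rotor.1.
Qed.

Lemma visits_le_deg v a b : no_overflow a b -> visits v a.+1 b.+1 <= deg e v.
Proof.
move=> noab; rewrite -size_entries /deg cardE.
by apply: uniq_leq_size (@sub_entries v a b); apply: uniq_entries.
Qed.

(** The predecessors of [v] are distinct neighbours of [v], so when there are [deg e v] of them they
    exhaust the neighbourhood. *)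
Lemma entry_exists u v a b : no_overflow a b -> visits v a.+1 b.+1 = deg e v ->
  e v u -> exists i, [/\ a <= i < b, w i = u & w i.+1 = v].
Proof.
move=> noab sat evu.
have [|_ eqE] := uniq_min_size (uniq_entries v noab) (@sub_entries v a b).
  by rewrite size_entries sat /deg cardE.
have : u \in entries v a b by rewrite eqE mem_enum inE.
case/mapP=> i; rewrite mem_filter mem_index_iota => /andP[/eqP wi1 ib] ->.
by exists i.
Qed.

(** * Phases, and how saturation spreads from one to the next *)

Definition phase (x : T) (a b : nat) : Prop :=
  [/\ a <= b, w a = x, w b = x, no_overflow a b & visits x a b = deg e x].

Lemma no_overflow_ind a b : a <= b ->
  (forall i, a <= i < b -> visits (w i) a i < deg e (w i)) -> no_overflow a b.
Proof.
move=> ab; rewrite -(subnKC ab); elim: (b - a) => [|k IHk] lt_deg u.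
  by rewrite addn0 /visits big_geq.
rewrite addnS visits_recr ?leq_addr //.
have IHu : visits u a (a + k) <= deg e u by apply: IHk => i ik; apply: lt_deg; lia.
by case: eqP => [<-|_]; rewrite ?addn0 // addn1; apply: lt_deg; lia.
Qed.

Lemma phase_exists a : exists b, phase (w a) a b.
Proof.
pose full t := (a <= t) && (deg e (w t) <= visits (w t) a t).
have : exists t, full t.
  (* Up to [B] there are more steps than arcs, so some vertex must overflow. *)
  pose B := (a + \sum_u deg e u).+1.
  have [/existsP[t] ft|/existsPn none] := boolP [exists t : 'I_B, full t].
    by exists t.
  have : no_overflow a B.
    apply: no_overflow_ind => [|i /andP[ai iB]]; first by rewrite /B; lia.
    by move: (none (Ordinal iB)); rewrite /full ai /= -ltnNge.
  move=> noB; have : \sum_u visits u a B <= \sum_u deg e u by apply: leq_sum.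
  by rewrite sum_visits /B; lia.
case/ex_minnP => b /andP[ab fb] min_b; exists b.
have noab : no_overflow a b.
  apply: no_overflow_ind => // i /andP[ai ib]; rewrite ltnNge; apply/negP => fi.
  by move: (min_b i); rewrite /full ai fi => /(_ isT); lia.
have satb : visits (w b) a b = deg e (w b) by apply/eqP; rewrite eqn_leq noab.
(* If [w b] were not the start, the arrival at time [b] would be entry number [deg + 1] into it. *)
have wba : w b = w a.
  have := visits_shift (w b) ab; have := visits_le_deg (w b) noab.
  by rewrite eqxx satb; case: eqP => //; lia.
by split; rewrite // -wba.
Qed.

Lemma phase_visits_shift x a b v : phase x a b ->
  visits v a.+1 b.+1 = visits v a b.
Proof. by case=> ab wa wb _ _; have := visits_shift v ab; rewrite wa wb; lia. Qed.

Lemma phase_entry x a b u v : phase x a b -> visits v a b = deg e v -> e v u ->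
  exists i, [/\ a <= i < b, w i = u & w i.+1 = v].
Proof.
by move=> ph sat; apply: entry_exists; [case: ph|rewrite (phase_visits_shift _ ph)].
Qed.

(* Following the last exits of the first phase leads back to x.  If the last
   exit of u goes to a vertex v saturated in the second phase, then the arc
   (u, v) is used again there, and it comes last in the rotor cycle of u. *)
Lemma visited_saturated x a b c i : phase x a b -> phase x b c ->
  a <= i < b -> visits (w i) b c = deg e (w i).
Proof.
move=> ph1 ph2; have [n] := ubnP (b - i); elim: n i => // n IHn i bi_n /andP[ai ib].
have [|] := posnP (visits (w i) i.+1 b); last first.
  by case/visits_gt0=> j jb <-; apply: IHn; lia.
move=> last_i; set u := w i in last_i *.
have [bc wb wc nobc satx] := ph2.
have satv : visits (w i.+1) b c = deg e (w i.+1).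
  have [i1b|bi1] := ltnP i.+1 b; first by apply: IHn; lia.
  by have -> : i.+1 = b by [lia]; rewrite wb.
have evu : e (w i.+1) u by rewrite e_sym w_rotor.1.
have [j [jb wj wj1]] := phase_entry ph2 satv evu.
have ij : i <= j by lia.
have := w_rotor.2 i j ij (esym wj) (esym wj1); rewrite -/u.
have [bj jc] : b <= j /\ j < c by lia.
have := nobc u; rewrite (visits_cat u bj (ltnW jc)) (visits_recl u jc) wj eqxx.
by rewrite (visits_cat u (ltnW ib) bj) (visits_recl u ib) last_i eqxx => + /dvdn_leq; lia.
Qed.

Fixpoint ball (x : T) (k : nat) : {set T} :=
  if k is k'.+1 then ball x k' :|: [set u | [exists v in ball x k', e v u]]
  else [set x].

Lemma ballP x k u :
  reflect (u \in ball x k \/ exists2 v, v \in ball x k & e v u)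
          (u \in ball x k.+1).
Proof.
rewrite /= !inE; apply: (iffP orP) => -[]; try by left.
  by case/exists_inP=> v; right; exists v.
by case=> v vk evu; right; apply/exists_inP; exists v.
Qed.

(** A vertex saturated in the first phase is entered from each of its neighbours, so these are
    visited there and [visited_saturated] applies to them. *)
Lemma ball_saturated x k a b c : (forall u, 0 < deg e u) ->
  phase x a b -> phase x b c ->
  (forall u, u \in ball x k -> visits u a b = deg e u) ->
  forall u, u \in ball x k.+1 -> visits u b c = deg e u.
Proof.
move=> deg_gt0 ph1 ph2 sat u /ballP[uk|[v vk evu]].
  have : 0 < visits u a b by rewrite sat.
  by case/visits_gt0=> i ib <-; apply: visited_saturated ph1 ph2 ib.
have [i [ib <- _]] := phase_entry ph1 (sat v vk) evu.
exact: visited_saturated ph1 ph2 ib.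
Qed.

(** * From arcs to edges, and the number of edges traversed *)

Definition edge_of (p : T * T) : {set T} := [set p.1; p.2].

(** The fibre of [edge_of] over an edge holds at most its two orientations. *)
Lemma card_le_edges (A : {set T * T}) : #|A| <= 2 * #|edge_of @: A|.
Proof.
rewrite -sum1_card (partition_big_imset edge_of) /= mulnC -sum_nat_const.
apply: leq_sum => _ /imsetP[[u v] _ ->]; rewrite sum1dep_card.
apply: leq_trans (subset_leq_card (_ : _ \subset [set (u, v); (v, u)])) _.
  apply/subsetP=> -[y z]; rewrite !inE /edge_of /= => /andP[_ /eqP/setP yz].
  have:= yz y; have:= yz z; have:= yz u; have := yz v.
  rewrite !inE !eqxx ?orbT /= !xpair_eqE.
  rewrite ![u == _]eq_sym ![v == _]eq_sym.
  by case: (y == u); case: (y == v); case: (z == u); case: (z == v).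
by rewrite cards2; case: eqP.
Qed.

Lemma mem_traversed i t : i < t -> edge_of (w i, w i.+1) \in traversed_edges w t.
Proof. by move=> it; apply/imsetP; exists (Ordinal it). Qed.

(* Every arc is used at most once in a phase, hence every edge at most twice. *)
Lemma phase_card_traversed a b t M : no_overflow a b -> t <= b ->
  a + 2 * M <= t -> M <= #|traversed_edges w t|.
Proof.
move=> noab tb aMt; pose arc (i : 'I_(2 * M)) := (w (a + i), w (a + i).+1).
have arc_inj : injective arc.
  move=> i j [wij wij1]; have [iM jM] := (ltn_ord i, ltn_ord j).
  by apply/val_inj/(@addnI a); apply: no_overflow_inj noab _ _ wij wij1; lia.
have := card_le_edges (arc @: setT).
rewrite card_imset // cardsT card_ord leq_pmul2l // => /leq_trans; apply.
apply: subset_leq_card; apply/subsetP => _ /imsetP[_ /imsetP[i _ ->] ->].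
by apply: mem_traversed; have := ltn_ord i; lia.
Qed.

Definition incident (B : {set T}) : {set {set T}} :=
  edge_of @: [set p | (p.1 \in B) && e p.1 p.2].

Lemma incident_traversed x a b (B : {set T}) : phase x a b ->
  (forall u, u \in B -> visits u a b = deg e u) ->
  incident B \subset traversed_edges w b.
Proof.
move=> ph sat; apply/subsetP => _ /imsetP[[u v] /[!inE]/= /andP[uB euv] ->].
have [i [/andP[_ ib] wi wi1]] := phase_entry ph (sat u uB) euv.
by move: (mem_traversed ib); rewrite wi wi1 /edge_of setUC.
Qed.

(** Induction on completed phases: the next one either ends within [2 * M] further steps, enlarging
    the saturated ball, or lasts long enough to traverse [M] edges. For [k = 0], every phase
    saturates its start. *)
Lemma traversed_ball M k : (forall u, 0 < deg e u) ->
  M <= #|traversed_edges w (2 * M * k)| \/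
  exists s, [/\ s <= 2 * M * k, w s = w 0 &
    forall b, phase (w 0) s b ->
    forall u, u \in ball (w 0) k -> visits u s b = deg e u].
Proof.
move=> deg_gt0; elim: k => [|k [IHk|[s [sk ws sat]]]].
- by right; exists 0; split=> // b [_ _ _ _ satx] u /set1P ->.
- left; apply: leq_trans IHk _; apply: subset_leq_card.
  apply/subsetP=> _ /imsetP[i _ ->]; apply: mem_traversed.
  by have := ltn_ord i; rewrite mulnS; lia.
have [b ph] := phase_exists s; rewrite ws in ph.
have [bk|kb] := leqP b (2 * M * k.+1); last first.
  left; have [_ _ _ nosb _] := ph.
  by apply: phase_card_traversed nosb (ltnW kb) _; rewrite mulnS; lia.
right; exists b; split=> // [|c ph2]; first by case: ph.
by apply: (ball_saturated deg_gt0 ph ph2); apply: sat.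
Qed.

Lemma traversed_incident_ball M k : (forall u, 0 < deg e u) ->
  M <= #|incident (ball (w 0) k)| -> M <= #|traversed_edges w (2 * M * k.+1)|.
Proof.
move=> deg_gt0 Mk; have sub_trav t t' : t <= t' ->
    traversed_edges w t \subset traversed_edges w t'.
  move=> tt'; apply/subsetP=> _ /imsetP[i _ ->]; apply: mem_traversed.
  exact: leq_trans tt'.
have [|[s [sk ws sat]]] := traversed_ball M k deg_gt0.
  move=> /leq_trans; apply; apply: subset_leq_card; apply: sub_trav.
  by rewrite mulnS leq_addl.
have [b ph] := phase_exists s; rewrite ws in ph.
have [bk|kb] := leqP b (2 * M * k.+1).
  apply: leq_trans Mk _; apply: subset_leq_card.
  exact: subset_trans (incident_traversed ph (sat b ph)) (sub_trav _ _ bk).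
have [_ _ _ nosb _] := ph.
by apply: phase_card_traversed nosb (ltnW kb) _; rewrite mulnS; lia.
Qed.

End RotorWalk.

(** * Degree counts and the growth of balls *)

Section Degrees.

Variables (T : finType) (e : rel T).

Lemma min_deg_le u : min_deg e <= deg e u.
Proof.
rewrite /min_deg; have := mem_index_enum u; elim: index_enum => // v s IHs.
rewrite inE big_cons geq_min => /predU1P[->|/IHs->]; first by rewrite leqnn.
by rewrite orbT.
Qed.

Lemma min_deg_gt0 (x : T) : (forall u, 0 < deg e u) -> 0 < min_deg e.
Proof.
move=> deg_gt0; rewrite /min_deg; elim/big_ind: _ => // [|m n m0 n0].
  by apply/card_gt0P; exists x.
by rewrite leq_min m0.
Qed.

Lemma card_arcs (B : {set T}) :
  #|[set p : T * T | (p.1 \in B) && e p.1 p.2]| = \sum_(u in B) deg e u.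
Proof.
rewrite -sum1dep_card -(pair_big_dep (mem B) e (fun _ _ => 1)) /=.
by apply: eq_bigr => u _; rewrite sum1dep_card.
Qed.

Lemma card_incident_ge (B : {set T}) :
  #|B| * min_deg e <= 2 * #|incident e B|.
Proof.
apply: leq_trans (card_le_edges _); rewrite card_arcs -sum_nat_const.
by apply: leq_sum => u _; apply: min_deg_le.
Qed.

Lemma card_incident_le (B : {set T}) : #|incident e B| <= #|B| * max_deg e.
Proof.
apply: leq_trans (leq_imset_card _ _) _; rewrite card_arcs -sum_nat_const.
by apply: leq_sum => u _; apply: leq_bigmax.
Qed.

Lemma incident_setT : incident e [set: T] = edges e.
Proof.
apply/setP=> E; apply/imsetP/imsetP=> -[p].
  by rewrite !inE => pe ->; exists p; rewrite ?inE.
by rewrite inE => pe ->; exists p; rewrite ?inE.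
Qed.

Hypotheses (e_sym : symmetric e) (e_conn : connected_graph e).

Lemma ball_sub x i j : i <= j -> ball e x i \subset ball e x j.
Proof.
move/subnKC <-; elim: (j - i) => [|k IHk]; first by rewrite addn0.
by rewrite addnS; apply: subset_trans IHk (subsetUl _ _).
Qed.

(** A ball without new neighbours is closed under [e], hence everything by connectedness. *)
Lemma ball_boundary x k : ball e x k != setT ->
  exists2 v, v \in ball e x k.+1 & v \notin ball e x k.
Proof.
have [/existsP[v /andP[]]|/existsPn no_new] :=
    boolP [exists v, (v \in ball e x k.+1) && (v \notin ball e x k)].
  by exists v.
case/negP; apply/eqP/setP => u; rewrite inE.
have xk : x \in ball e x k by apply: (subsetP (ball_sub x (leq0n k))); rewrite set11.
have step v w : e v w -> v \in ball e x k -> w \in ball e x k.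
  move=> evw vk; apply: contraT => wk; have := no_new w.
  by rewrite wk andbT; case/negP; apply/ballP; right; exists v.
have cl : closed e (mem (ball e x k)).
  by move=> v w evw; apply/idP/idP; apply: step; rewrite // e_sym.
by have := closed_connect cl (e_conn x u) => /= <-.
Qed.

(* A vertex at distance k + 2 has its whole neighbourhood at distance between
   k + 1 and k + 3. *)
Lemma ball_growth x k : ball e x k.+1 != setT ->
  #|ball e x k| + min_deg e <= #|ball e x k.+3|.
Proof.
case/ball_boundary => v vk2 vk1; set N := [set u | e v u].
have dis : [disjoint ball e x k & N].
  apply/pred0P => u /=; apply/negP => /andP[uk /[!inE] evu].
  by case/negP: vk1; apply/ballP; right; exists u; rewrite // e_sym.
apply: leq_trans (leq_add (leqnn _) (min_deg_le v)) _.
rewrite -[_ + _]cardsUI disjoint_setI0 // cards0 addn0; apply: subset_leq_card.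
rewrite subUset ball_sub; last lia.
apply/subsetP=> u uN; apply/ballP; right; exists v => //.
by rewrite inE in uN.
Qed.

(** Each three units of radius gain a whole neighbourhood. *)
Lemma card_ball_ge x q : ball e x (3 * q) != setT ->
  q * min_deg e <= #|ball e x (3 * q)|.
Proof.
elim: q => // q IHq nT.
have sub_nT k : k <= 3 * q.+1 -> ball e x k != setT.
  move=> /(ball_sub x) sub; apply: contraNneq nT => kT.
  by rewrite -subTset -kT.
have := IHq (sub_nT _ _); have := ball_growth (sub_nT (3 * q).+1 _).
have -> : 3 * q.+1 = (3 * q).+3 by lia.
by rewrite mulSn; lia.
Qed.

End Degrees.

(** * Cover times for edges and vertices *)

Section Cover.

Variables (T : finType) (e : rel T) (w : nat -> T).
Hypotheses (e_sym : symmetric e) (e_conn : connected_graph e).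
Hypotheses (deg_gt0 : forall u, 0 < deg e u) (w_rotor : rotor_walk e w).

(** The time bound is multiplied by the squared minimum degree to stay within [nat]. The witness
    uses the least [q] for which the ball of radius [3 * q] has [M] incident edges. *)
Lemma edge_cover_time M : 0 < M <= #|edges e| ->
  exists2 t, t * min_deg e ^ 2 <= 12 * (M * min_deg e ^ 2 + M ^ 2)
           & M <= #|traversed_edges w t|.
Proof.
case/andP=> M0 Mm; have d0 := min_deg_gt0 (w 0) deg_gt0.
pose reached q := M <= #|incident e (ball e (w 0) (3 * q))|.
have not_reached q : ~~ reached q ->
    q * min_deg e <= #|ball e (w 0) (3 * q)|.
  move=> nq; apply: card_ball_ge => //; apply: contraNneq nq => qT.
  by rewrite /reached qT incident_setT.
have : exists q, reached q.
  (* Otherwise this ball would have more than [#|T|] vertices. *)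
  exists #|T|.+1; apply: contraT => /not_reached Tball.
  by have := leq_trans (leq_pmulr _ d0) (leq_trans Tball (max_card _)); rewrite ltnn.
case/ex_minnP=> q Mq min_q; exists (2 * M * (3 * q).+1); last first.
  exact: traversed_incident_ball.
case: q Mq min_q => [|q] _ min_q; first by lia.
have nq : ~~ reached q by apply/negP=> /min_q; rewrite ltnn.
have := not_reached q nq; have := card_incident_ge e (ball e (w 0) (3 * q)).
move: nq; rewrite /reached -ltnNge; move: (min_deg e) (#|_|) (#|_|) => d I B IM BI qB.
(* Here [q] is one less than the least radius index, so [t = 6 * M * q + 8 * M], and this bound
   gives at most [12 * M ^ 2 + 8 * M * d ^ 2] after multiplication by [d ^ 2]. *)
have : q * d * d <= 2 * M by nia.
rewrite -!mulnn; nia.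
Qed.

Lemma traversed_sub_incident t :
  traversed_edges w t \subset incident e (visited_vertices w t).
Proof.
apply/subsetP=> _ /imsetP[i _ ->].
apply/imsetP; exists (w i, w i.+1); rewrite // inE w_rotor.1 andbT.
by apply/imsetP; exists (widen_ord (leqnSn t) i).
Qed.

Lemma edge_cover_vertex_cover t : #|edges e| <= #|traversed_edges w t| ->
  visited_vertices w t = setT.
Proof.
move=> all_t; have sub : traversed_edges w t \subset edges e.
  apply/subsetP=> _ /imsetP[i _ ->]; apply/imsetP; exists (w i, w i.+1) => //.
  by rewrite inE w_rotor.1.
have eqE : traversed_edges w t = edges e by apply/eqP; rewrite eqEcard sub.
apply/setP=> u; rewrite inE.
have /card_gt0P[v /[!inE] euv] := deg_gt0 u.
have : [set u; v] \in traversed_edges w t.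
  by rewrite eqE; apply/imsetP; exists (u, v); rewrite ?inE.
case/imsetP=> i _ /setP/(_ u); rewrite !inE eqxx /= => /esym/orP[]/eqP->.
  by apply/imsetP; exists (widen_ord (leqnSn t) i).
by apply/imsetP; exists (lift ord0 i).
Qed.

(** Every traversed edge touches a visited vertex, and each vertex touches at most [max_deg e]
    edges. If instead all edges are traversed, all vertices are visited. *)
Lemma vertex_cover N t : N <= #|T| ->
  minn (N * max_deg e) #|edges e| <= #|traversed_edges w t| ->
  N <= #|visited_vertices w t|.
Proof.
move=> NT; rewrite geq_min => /orP[Nt|/edge_cover_vertex_cover->]; last first.
  by rewrite cardsT.
have D0 : 0 < max_deg e by apply: leq_trans (deg_gt0 (w 0)) (leq_bigmax _).
rewrite -(leq_pmul2r D0); apply: leq_trans Nt _.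
apply: leq_trans (card_incident_le _ _).
exact: subset_leq_card (traversed_sub_incident t).
Qed.

End Cover.

(** * Deterministic walks with [kappa] equal to 1 are rotor walks *)

Section DeterministicWalk.

Variables (T : finType) (e : rel T) (rseq : T -> seq T) (pos : T -> nat) (x : T).
Hypotheses (rseqP : rotor_sequences e rseq) (kappa1 : kappa e rseq = 1).
Hypothesis posP : rotor_positions rseq pos.

Lemma rotor_deg_gt0 u : 0 < deg e u.
Proof.
by have [s0 ds _ _] := rseqP u; have := dvdn_gt0 s0 ds.
Qed.

Lemma size_rseq u : size (rseq u) = deg e u.
Proof.
have [s0 ds _ _] := rseqP u.
have : size (rseq u) %/ deg e u <= 1.
  by rewrite -kappa1; apply: (leq_bigmax (F := fun u => size (rseq u) %/ deg e u)).
by have := divnK ds; case: (_ %/ _) => [|[|]] //; lia.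
Qed.

Lemma rseq_uniq u : uniq (rseq u).
Proof.
have [s0 _ sub cnt] := rseqP u; apply: count_mem_uniq => v.
have [vs|] := boolP (v \in rseq u); last by move/count_memPn.
by rewrite cnt ?size_rseq ?divnn ?rotor_deg_gt0 //; apply: sub.
Qed.

Let w := walk rseq pos x.
Let rotor t := (iter t (walk_step rseq) (x, pos)).2.

Lemma walkS t : w t.+1 = nth (w t) (rseq (w t)) (rotor t (w t)).
Proof. by rewrite /w /rotor /walk iterS; case: (iter t _ _). Qed.

Lemma rotorE t u : rotor t u = (pos u + visits w u 0 t) %% size (rseq u).
Proof.
elim: t => [|t IHt]; first by rewrite /visits big_geq // addn0 modn_small.
have -> : rotor t.+1 u =
    if u == w t then (rotor t u).+1 %% size (rseq u) else rotor t u.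
  rewrite /w /rotor /walk iterS; case: (iter t _ _) => y p /=.
    by case: eqP => [->|].
rewrite visits_recr // IHt eq_sym; case: eqP => _; last by rewrite addn0.
by rewrite -addn1 modnDml addnA.
Qed.

(** Rotor sequences have no repetition, so a repeated arc means equal rotor positions, and these are
    departure counts modulo the degree. *)
Lemma deterministic_rotor_walk : rotor_walk e w.
Proof.
have rotor_lt t u : rotor t u < size (rseq u).
  by rewrite rotorE ltn_mod; case: (rseqP u).
split=> [i|i j ij ww ww1].
  by have [_ _ sub _] := rseqP (w i); rewrite walkS; apply/sub/mem_nth/rotor_lt.
move/eqP: ww1; rewrite !walkS -ww nth_uniq ?rseq_uniq ?rotor_lt // !rotorE.
rewrite (visits_cat w _ (leq0n i) ij) addnA -[X in X == _ %[mod _]]addn0.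
by rewrite eqn_modDl mod0n eq_sym size_rseq.
Qed.

End DeterministicWalk.

(** * The bounds over the rationals *)

Import Order.TTheory GRing.Theory Num.Theory.
Local Open Scope ring_scope.

Theorem theorem5p1 :
  exists C : rat,
  forall (T : finType) (e : rel T),
  simple_graph e -> connected_graph e ->
  forall (rseq : T -> seq T) (pos : T -> nat) (x : T),
  rotor_sequences e rseq -> kappa e rseq = 1%N -> rotor_positions rseq pos ->
  let w := walk rseq pos x in
  let m : rat := #|edges e|%:R in
  let delta : rat := (min_deg e)%:R in
  let Delta : rat := (max_deg e)%:R in
  (forall N : nat, (1 <= N <= #|T|)%N ->
     exists t : nat,
       t%:R <= C * Num.min (N%:R * Delta + (N%:R * Delta / delta) ^+ 2)
                           (m + (m / delta) ^+ 2)
       /\ (N <= #|visited_vertices w t|)%N)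
  /\
  (forall M : nat, (1 <= M <= #|edges e|)%N ->
     exists t : nat,
       t%:R <= C * (M%:R + (M%:R / delta) ^+ 2)
       /\ (M <= #|traversed_edges w t|)%N).
Proof.
exists 12 => T e [e_sym _] e_conn rseq pos x rseqP kappa1 posP w m delta Delta.
have w_rotor : rotor_walk e w by apply: deterministic_rotor_walk.
have deg_gt0 := rotor_deg_gt0 rseqP.
have delta_gt0 : 0 < delta by rewrite ltr0n; apply: min_deg_gt0.
have edge_time M : (1 <= M <= #|edges e|)%N -> exists t : nat,
    t%:R <= 12 * (M%:R + (M%:R / delta) ^+ 2) :> rat
    /\ (M <= #|traversed_edges w t|)%N.
  case/(edge_cover_time e_sym e_conn deg_gt0 w_rotor) => t t_le Mt.
  exists t; split=> //.
  (* Multiplying by [delta ^+ 2] clears the denominators and returns to [nat]. *)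
  rewrite -(ler_pM2r (exprn_gt0 2 delta_gt0)) -mulrA [X in _ <= _ * X]mulrDl -exprMn.
  rewrite divfK ?gt_eqF // -!natrX -!natrM -natrD -natrM ler_nat.
  exact: t_le.
split=> // N /andP[N1 NT].
have D_gt0 : (0 < max_deg e)%N by apply: leq_trans (deg_gt0 x) (leq_bigmax _).
pose M := minn (N * max_deg e) #|edges e|.
have m_gt0 : (0 < #|edges e|)%N.
  have /card_gt0P[v /[!inE] exv] := deg_gt0 x.
  by apply/card_gt0P; exists [set x; v]; apply/imsetP; exists (x, v); rewrite ?inE.
have [|t [t_le Mt]] := edge_time M.
  by rewrite geq_minr andbT leq_min muln_gt0 N1 D_gt0 m_gt0.
exists t; split; last exact: vertex_cover Mt.
apply: le_trans t_le _; rewrite ler_pM2l //.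
(* The edge bound increases with the number of edges, so its value at [M] is below both terms of the
   minimum. *)
have mono (a b : nat) : (a <= b)%N ->
    a%:R + (a%:R / delta) ^+ 2 <= b%:R + (b%:R / delta) ^+ 2.
  move=> ab; rewrite lerD ?ler_nat // lerXn2r ?nnegrE ?divr_ge0 ?ler0n //.
  by rewrite ler_pM2r ?invr_gt0 // ler_nat.
by rewrite le_min -natrM !mono ?geq_minl ?geq_minr.
Qed.
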